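(* Let $t\in \{1, 2, 3, 4\}$. Then for all integers $n\geq 0$, $$\overline{\mathcal{EO}}(10(5n+t)+8) \equiv 0\pmod{20}.$$
   Context: For a nonnegative integer $n$, $\mathcal{EO}(n)$ is the number of partitions of $n$ in which every even part is less than each odd part. $\overline{\mathcal{EO}}(n)$ is the number of partitions counted by $\mathcal{EO}(n)$ in which only the largest even part appears an odd number of times (that is, if the partition has an even part, then the largest even part appears an odd number of times and every other part size that occurs appears an even number of times; if there are no even parts, every part size that occurs appears an even number of times). For example $\overline{\mathcal{EO}}(8)=5$, the relevant partitions being $8$, $4+2+2$, $3+3+2$, $3+3+1+1$, $1+1+1+1+1+1+1+1$. Equivalently (Andrews), $\overline{\mathcal{EO}}(n)$ is given by the generating function $$\sum_{n=0}^{\infty}\overline{\mathcal{EO}}(n)q^n=\frac{(q^4; q^4)_{\infty}^3}{(q^2; q^2)_{\infty}^2},\qquad (a; q)_{\infty}:=\prod_{m\geq 0}(1-aq^m).$$ *)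

(* Defs.v *)
From mathcomp Require Import all_boot.

Set Implicit Arguments.
Unset Strict Implicit.
Unset Printing Implicit Defensive.

Definition is_partition (n : nat) (s : seq nat) : bool :=
  [&& sorted geq s, 0 \notin s & sumn s == n].

Definition EO_cond (s : seq nat) : bool :=
  allrel ltn [seq p <- s | ~~ odd p] [seq p <- s | odd p].

(* The value is 0, which is never a part, when there are no even parts. *)
Definition largest_even (s : seq nat) : nat :=
  \max_(p <- s | ~~ odd p) p.

Definition EObar_cond (s : seq nat) : bool :=
  EO_cond s && all (fun p => odd (count_mem p s) == (p == largest_even s)) s.

(* A partition of n has at most n parts, each at most n, so the finite type
   n.-bseq 'I_n.+1 contains all of them (see EObar_enum). *)
Definition EObar (n : nat) : nat :=
  #|[set s : n.-bseq 'I_n.+1 | is_partition n (map val s) &&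
                               EObar_cond (map val s)]|.

Lemma size_partition n s : is_partition n s -> size s <= n.
Proof.
case/and3P=> _ + /eqP <-; elim: s => //= x s IHs; rewrite inE negb_or eq_sym.
by rewrite -lt0n => /andP[x0 /IHs le_s]; rewrite -add1n leq_add.
Qed.

Lemma part_le n s p : is_partition n s -> p \in s -> p <= n.
Proof.
case/and3P=> _ _ /eqP <-; elim: s => //= x s IHs; rewrite inE.
case/predU1P=> [-> | /IHs le_ps]; first exact: leq_addr.
exact: leq_trans le_ps (leq_addl _ _).
Qed.

(* EObar n is the length of any duplicate-free list of the partitions of n
   that satisfy EObar_cond. *)
Lemma EObar_enum n (L : seq (seq nat)) : uniq L ->
  (forall s, (s \in L) = is_partition n s && EObar_cond s) ->
  EObar n = size L.
Proof.
move=> uL LP; rewrite /EObar cardE.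
pose f (s : n.-bseq 'I_n.+1) := map val s.
rewrite -(size_map f); apply/perm_size/uniq_perm => //.
  rewrite map_inj_uniq ?enum_uniq // => s t /(inj_map val_inj) /val_inj //.
move=> s; rewrite LP; apply/mapP/idP => [[t + ->] | Ps].
  by rewrite mem_enum inE.
have [Pn _] := andP Ps.
pose r := map (@inord n) s.
have sz_r : size r <= n by rewrite size_map size_partition.
have Er : map val r = s.
  rewrite -map_comp -[RHS]map_id; apply/eq_in_map => p ps /=.
  by rewrite inordK // ltnS (part_le Pn).
by exists (Bseq sz_r); rewrite ?mem_enum ?inE /f /= Er.
Qed.

(* Main.v *)
Require Import Defs.
From mathcomp Require Import all_boot.
From mathcomp Require Import all_order all_algebra qpoly ring zify.

(** Write f_k for the product of the 1 - y^(k i), i >= 1.  Sorting the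
partitions counted by [EObar] by their largest even part 2k gives, with
y = X^2,

   sum_N EObar(2N) y^N
     = sum_k y^k / ((1 - y^2)...(1 - y^(2k)) * prod_(i >= k) (1 - y^(2i+1))),

which the q-binomial theorem sums to f_2^3 / f_1^2 ([EObar_series_euler]).
The theorem concerns N = 5(5n + t) + 4, for which N = 4 mod 5 and 6N + 1 is
divisible by 5 exactly once.

Modulo 5, f_1^5 = f_5, so that f_5 times the series is f_1^3 f_2^3.  By
Jacobi's formula for f_1^3, this is a combination of the y^e where
8e + 3 = x^2 + 2z^2 with x, z odd and coefficient a multiple of x z.  If
e = 4 mod 5, then 5 divides x^2 + 2z^2, and since -2 is not a square modulo 5,
5 divides x.  Hence the coefficients at exponents 4 mod 5 vanish; dividing by
f_5, a series in y^5, does not change this ([EObar_dvd5]).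

Modulo 4, f_1^4 = f_2^2, so that the series is f_1^2 f_2.  Gauss's formula
f_1^2 = theta(y) f_2, where theta(y) = 1 + 2 S(y) modulo 4 with
S(y) = sum_(s >= 1) y^(s^2), applied to y and to y^2 turns this into
f_4 + 2 S(y^2) f_4 + 2 S(y) f_4.  By Euler's pentagonal number theorem, the
coefficients at N of these three terms count, with signs, the solutions of
6N + 1 = X^2, X^2 + 12 Y^2 and X^2 + 6 Y^2 with X >= 1 and Y >= 1.  As 5 divides
6N + 1 exactly once and -12 is not a square modulo 5, the first two equations
have no solution.  The third may have some, but their number is even: 5 splits
in Q(sqrt -6) into two conjugate primes, and exchanging them in the
factorization of X + Y sqrt(-6) is an involution of the solutions without fixed
point ([form_involutionP]).  With the factor 2 this gives divisibility by 4
([EObar_dvd4]).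

All series are handled in an arbitrary commutative ring containing an element q
with q^(n+1) = 0: there infinite products are finite, factors 1 - q^i can be
cancelled, and identities hold exactly.  Only [truncated_series_ring] provides
such a ring with a coefficient function. *)

Set Implicit Arguments.
Unset Strict Implicit.
Unset Printing Implicit Defensive.

Import GRing.Theory.
Local Open Scope ring_scope.

(** * Power series truncated at a nilpotent variable *)

(** The ring is R[X]/(X^(n+1)), q is the class of X and [cf] takes the
coefficient of X^n.  The last clause transfers the characteristic, so that
congruences of integers become equalities in the ring. *)
Lemma truncated_series_ring (R : comNzRingType) (n : nat) :
  exists (A : comNzRingType) (q : A) (cf : {additive A -> R}),
  [/\ q ^+ n.+1 = 0, forall e, cf (q ^+ e) = (e == n)%:R
    & forall m, m%:R = 0 :> R -> m%:R = 0 :> A].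
Proof.
set h : {poly R} := 'X^(n.+1).
have hE : mk_monic h = h by rewrite mk_monic_Xn.
exists ({poly %/ h} : comNzRingType), (in_qpoly h 'X).
exists (coefp n \o @polyn R _ : {additive _ -> _}).
have small e : (e <= n)%N -> in_qpoly h 'X^e = 'X^e :> {poly R}.
  by move=> le_en; rewrite in_qpoly_small // hE !size_polyXn.
have q0 : in_qpoly h 'X ^+ n.+1 = 0.
  rewrite -rmorphXn; apply: val_inj => /=.
  by rewrite hE Pdiv.RingMonic.rmodpp ?monicXn.
split=> // [e | m m0].
- have [le_en | lt_ne] := leqP e n.
    rewrite -rmorphXn; transitivity ((in_qpoly h 'X^e : {poly R})`_n) => //.
    by rewrite small // coefXn eq_sym.
  by rewrite (gtn_eqF lt_ne) -(subnKC lt_ne) exprD q0 mul0r raddf0.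
- by apply: val_inj; apply: etrans (qpolyC_natr h m) _; rewrite -polyC_natr m0.
Qed.

(** If (1 - y) c = 0, then c = y c = y^2 c = ... = 0. *)
Lemma nilpotent_cancel (A : comNzRingType) (n : nat) (y a b : A) :
  y ^+ n = 0 -> (1 - y) * a = (1 - y) * b -> a = b.
Proof.
move=> y0 E.
have ab i : a - b = y ^+ i * (a - b).
  elim: i => [|i IHi]; first by rewrite mul1r.
  rewrite exprSr -mulrA.
  suff -> : y * (a - b) = a - b by [].
  apply: subr0_eq; transitivity ((1 - y) * b - (1 - y) * a); first by ring.
  by rewrite E subrr.
by apply: subr0_eq; rewrite (ab n) y0 mul0r.
Qed.

Lemma nilpotentX (A : comNzRingType) (M m : nat) (y : A) :
  y ^+ M = 0 -> (0 < m)%N -> (y ^+ m) ^+ M = 0.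
Proof. by move=> y0 m0; rewrite exprAC y0 expr0n gtn_eqF. Qed.

Lemma nilpotent_ge (A : comNzRingType) (M m : nat) (y : A) :
  y ^+ M = 0 -> (M <= m)%N -> y ^+ m = 0.
Proof. by move=> y0 /subnKC <-; rewrite exprD y0 mul0r. Qed.

Lemma nilpotent_exp_gt0 (A : comNzRingType) (M : nat) (y : A) :
  y ^+ M = 0 -> (0 < M)%N.
Proof. by case: M => // /eqP; rewrite expr0 oner_eq0. Qed.

(** With y^M = 0, the value does not depend on m >= M, and is the infinite
product (y; y)_oo of a truncated series. *)
Definition euler (A : comNzRingType) (y : A) (m : nat) : A :=
  \prod_(i < m) (1 - y ^+ i.+1).

Lemma eulerS (A : comNzRingType) (y : A) m :
  euler y m.+1 = euler y m * (1 - y ^+ m.+1).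
Proof. by rewrite /euler big_ord_recr. Qed.

Lemma euler_stable (A : comNzRingType) (M : nat) (y : A) m :
  y ^+ M = 0 -> (M <= m)%N -> euler y m = euler y M.
Proof.
move=> y0; elim: m => [|m IHm]; first by rewrite leqn0 => /eqP ->.
rewrite leq_eqVlt => /predU1P[-> // | lt_Mm].
by rewrite eulerS IHm // (nilpotent_ge y0 (ltnW _)) // subr0 mulr1.
Qed.

Lemma euler_cancel (A : comNzRingType) (M : nat) (y : A) m (a b : A) :
  y ^+ M = 0 -> euler y m * a = euler y m * b -> a = b.
Proof.
move=> y0; elim: m a b => [|m IHm] a b; first by rewrite /euler big_ord0 !mul1r.
rewrite eulerS -!mulrA => /IHm; apply: (@nilpotent_cancel _ M).
exact: nilpotentX.
Qed.

Definition odd_euler (A : comNzRingType) (y : A) (m : nat) : A :=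
  \prod_(i < m) (1 - y ^+ i.*2.+1).

Lemma euler_double (A : comNzRingType) (y : A) m :
  euler y m.*2 = euler (y ^+ 2) m * odd_euler y m.
Proof.
elim: m => [|m IHm]; first by rewrite /euler /odd_euler !big_ord0 mulr1.
rewrite doubleS !eulerS IHm /odd_euler big_ord_recr /=.
by rewrite -exprM mulnS mul2n !exprS; ring.
Qed.

(** * Finite Jacobi triple product *)

(** Gaussian binomials, defined by one Pascal rule so as to make sense when
the 1 - p^i are not invertible. *)
Fixpoint qbin (A : comNzRingType) (p : A) (m j : nat) : A :=
  match m, j with
  | _, 0 => 1
  | 0, _.+1 => 0
  | m'.+1, j'.+1 => qbin p m' j'.+1 + p ^+ (m' - j') * qbin p m' j'
  end.

Arguments qbin : simpl never.

Section TripleProduct.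

Variables (A : comNzRingType) (p : A).
Local Notation qb := (qbin p).

Lemma qbinn0 m : qb m 0 = 1. Proof. by case: m. Qed.

Lemma qbinSS m j : qb m.+1 j.+1 = qb m j.+1 + p ^+ (m - j) * qb m j.
Proof. by []. Qed.

Lemma qbin_small m j : (m < j)%N -> qb m j = 0.
Proof.
elim: m j => [|m IHm] [|j] //; rewrite ltnS => lt_mj.
by rewrite qbinSS !IHm ?mulr0 ?addr0 // ltnW.
Qed.

(** The second Pascal rule: the induction for the triple product uses one rule
to add a factor on the right, and this one to add a factor on the left. *)
Lemma qbin_pascal m j : qb m.+1 j.+1 = p ^+ j.+1 * qb m j.+1 + qb m j.
Proof.
elim: m j => [|m IHm] j.
  by rewrite qbinSS sub0n mulr0 mul1r.
rewrite qbinSS [in RHS]qbinSS.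
case: j => [|j].
  rewrite !qbinn0 {1}IHm !qbinn0 subn0 subn0 !mulr1.
  by rewrite mulrDr -exprD add1n; ring.
rewrite {1}IHm {1}IHm {}[in X in _ = _ + X]qbinSS subSS.
have [lt_jm | le_mj] := ltnP j m.
  have -> : (m - j)%N = (m - j.+1).+1 by lia.
  rewrite !exprS; ring.
have -> : qb m j.+2 = 0 by apply: qbin_small; lia.
have -> : qb m j.+1 = 0 by apply: qbin_small; lia.
have -> : (m - j = 0)%N by lia.
by ring.
Qed.

Lemma qbin_euler i j : qb (i + j) j * (euler p j * euler p i) = euler p (i + j).
Proof.
have E0 : euler p 0 = 1 by rewrite /euler big_ord0.
elim: j i => [|j IHj] i; first by rewrite addn0 qbinn0 E0 !mul1r.
elim: i => [|i IHi].
  rewrite add0n E0 mulr1.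
  suff -> : qb j.+1 j.+1 = 1 by rewrite mul1r.
  by elim: {IHj}j.+1 => // k IHk; rewrite qbinSS IHk subnn qbin_small // mul1r add0r.
rewrite addSn qbin_pascal mulrDl.
rewrite [X in p ^+ _ * _ * (_ * X)]eulerS.
rewrite [X in _ + _ * (X * _)]eulerS.
have {}IHj := IHj i.+1; rewrite addSnnS in IHj.
rewrite [RHS]eulerS -addSn.
have -> : (i.+1 + j.+1 = j.+1 + i.+1)%N by rewrite addnC.
rewrite exprD.
transitivity (p ^+ j.+1 * (1 - p ^+ i.+1) * euler p (i + j.+1)
              + (1 - p ^+ j.+1) * euler p (i + j.+1)); last by ring.
by rewrite -{1}IHi -{1}IHj; ring.
Qed.

Variables v w x : A.

(** For x w = p v this is v^a p^(d(d-1)/2) (-x)^d where d = j - a is an integer: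
the truncated subtractions select the power of - x for d >= 0 and that of - w
for d <= 0, which avoids division by x. *)
Definition tp_term (a j : nat) : A :=
  v ^+ minn a j * (- x) ^+ (j - a) * (- w) ^+ (a - j)
  * p ^+ ('C(j - a, 2) + 'C(a - j, 2)).

Lemma tp_term_ge a s : tp_term a (a + s) = v ^+ a * (- x) ^+ s * p ^+ 'C(s, 2).
Proof.
rewrite /tp_term addKn.
have -> : minn a (a + s) = a by lia.
by have -> : (a - (a + s) = 0)%N by [lia]; rewrite addn0 mulr1.
Qed.

Lemma tp_term_le j s : tp_term (j + s) j = v ^+ j * (- w) ^+ s * p ^+ 'C(s, 2).
Proof.
rewrite /tp_term addKn.
have -> : minn (j + s) j = j by lia.
by have -> : (j - (j + s) = 0)%N by [lia]; rewrite mulr1.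
Qed.

Lemma triple_product_left a :
  \prod_(i < a) (v - w * p ^+ i) = \sum_(j < a.+1) qb a j * tp_term a j.
Proof.
elim: a => [|a IHa].
  by rewrite big_ord0 big_ord1 (tp_term_le 0 0) /= !mulr1.
have stepv j : (j <= a)%N -> tp_term a.+1 j.+1 = v * tp_term a j.
  by move=> le_ja; rewrite -(subnKC le_ja) -addSn !tp_term_le exprS !mulrA.
have stepw j : (j <= a)%N ->
    - (w * p ^+ a * tp_term a j) = p ^+ j * tp_term a.+1 j.
  move=> /subnKC <-; rewrite -addnS.
  by rewrite !tp_term_le binS bin1 !exprD !exprS; ring.
rewrite big_ord_recr /= {}IHa mulrC mulrBl !mulr_sumr.
rewrite [RHS]big_ord_recl /=.
under [in RHS]eq_bigr => j _.
  rewrite [bump _ _]add1n qbin_pascal mulrDl.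
  rewrite stepv; last by rewrite -ltnS.
  over.
rewrite big_split /= addrA [LHS]addrC; congr (_ + _); first last.
  by apply: eq_bigr => j _; rewrite mulrCA.
rewrite [in RHS]big_ord_recr /= (@qbin_small a a.+1) // mulr0 mul0r addr0.
rewrite [in LHS]big_ord_recl /= qbinn0.
rewrite opprD; congr (_ + _).
  by rewrite mul1r stepw // mul1r.
rewrite -sumrN; apply: eq_bigr => j _; rewrite [bump _ _]add1n.
rewrite mulrCA -mulrN stepw //.
by rewrite stepv ?(ltnW (ltn_ord j)) //; ring.
Qed.

Hypothesis xw : x * w = p * v.

(** Moving one step to the right multiplies a term by - x p^(j-a); on the
left of a this power of p is negative, and x w = p v compensates for it. *)
Lemma tp_term_step a b j : (j <= a + b)%N ->
  tp_term a j * (x * p ^+ b) = - (p ^+ (a + b - j) * tp_term a j.+1).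
Proof.
move=> le_jab; have [le_aj | lt_ja] := leqP a j.
  have [s Es] : exists s, (j : nat) = (a + s)%N by exists (j - a)%N; lia.
  have [r Er] : exists r, b = (s + r)%N by exists (b - s)%N; lia.
  have -> : (a + b - j = r)%N by lia.
  by rewrite Er Es -addnS !tp_term_ge binS bin1 !exprD !exprS; ring.
have [s Es] : exists s, a = (j + s.+1)%N by exists (a - j.+1)%N; lia.
have -> : (a + b - j = s + b + 1)%N by lia.
rewrite {1}Es tp_term_le.
have -> : tp_term a j.+1 = v ^+ j.+1 * (- w) ^+ s * p ^+ 'C(s, 2).
  by rewrite Es -addSnnS tp_term_le.
rewrite binS bin1 !exprD !exprS.
transitivity (- v ^+ j * (- w) ^+ s * p ^+ 'C(s, 2) * p ^+ s * p ^+ b * (x * w)).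
  by ring.
by rewrite xw; ring.
Qed.

(** A finite form of the Jacobi triple product.  Stating
it with x w = p v instead of w / v = p / x avoids dividing by elements that are
not invertible in a truncated ring, and allows x = v to be an indeterminate, as
Jacobi's formula requires. *)
Lemma triple_product a b :
  (\prod_(i < a) (v - w * p ^+ i)) * (\prod_(i < b) (1 - x * p ^+ i))
  = \sum_(j < (a + b).+1) qb (a + b) j * tp_term a j.
Proof.
elim: b => [|b IHb]; first by rewrite big_ord0 mulr1 addn0 triple_product_left.
rewrite big_ord_recr /= mulrA {}IHb mulrBr mulr1 addnS.
rewrite [RHS]big_ord_recl /= qbinn0.
under [in RHS]eq_bigr => j _ do rewrite [bump _ _]add1n qbinSS mulrDl.
rewrite big_split /= addrA; congr (_ + _).
  rewrite [in RHS]big_ord_recr /= qbin_small // mul0r addr0.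
  by rewrite big_ord_recl /= qbinn0.
rewrite mulr_suml -sumrN; apply: eq_bigr => j _.
by rewrite -(mulrA (qb _ _)) tp_term_step -1?ltnS //; ring.
Qed.

(** Letting a and b grow.  A term whose distance to the center is more than M
contains p^(M+1 choose 2) = 0; for the others both j and a + b - j are at
least M, so that the Gaussian binomial is the inverse of the Euler product. *)
Lemma triple_product_nilpotent M a b :
  p ^+ M = 0 -> (M.*2 <= a)%N -> (M.*2 <= b)%N ->
  euler p M * ((\prod_(i < a) (v - w * p ^+ i)) *
               (\prod_(i < b) (1 - x * p ^+ i)))
  = \sum_(j < (a + b).+1) tp_term a j.
Proof.
move=> p0 le_a le_b; rewrite triple_product mulr_sumr; apply: eq_bigr => j _.
have M0 := nilpotent_exp_gt0 p0.
have [small | big] := boolP ((a - M <= j) && (j <= a + M))%N.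
  have [i Ei] : exists i, (a + b = i + j)%N.
    by exists (a + b - j)%N; have := ltn_ord j; lia.
  suff -> : euler p M * (qb (a + b) j * tp_term a j)
          = euler p M * qb (a + b) j * tp_term a j.
    suff -> : euler p M * qb (a + b) j = 1 by rewrite mul1r.
    apply: (@euler_cancel _ M p M _ _ p0).
    have := qbin_euler i j; rewrite -Ei !(euler_stable p0); try lia.
    by move=> E; rewrite mulr1 -[RHS]E; ring.
  by rewrite mulrA.
suff -> : tp_term a j = 0 by rewrite !mulr0.
have C2 s : (M < s)%N -> p ^+ 'C(s, 2) = 0.
  move=> lt_Ms; apply: (nilpotent_ge p0); apply: leq_trans (leq_bin2l 2 lt_Ms).
  by rewrite binS bin1 leq_addl.
rewrite /tp_term exprD; have [le_M | lt_M] := leqP (j - a) M.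
  by rewrite (C2 (a - j)%N) ?mulr0 //; move: big; rewrite negb_and; lia.
by rewrite (C2 (j - a)%N) // mul0r mulr0.
Qed.

End TripleProduct.

(** * The theta series of Euler, Gauss and Jacobi *)

(** The pentagonal numbers s(3s - 1)/2 for j = a + s and s(3s + 1)/2 for
j = a - s: the index j runs over a segment of the integers centered at a. *)
Definition pentagonal (a j : nat) : nat :=
  ((j - a) + (a - j).*2 + 3 * ('C(j - a, 2) + 'C(a - j, 2)))%N.

(** The absolute value of 6s - 1, where j = a + s with s an integer. *)
Definition pentagonal_root (a j : nat) : nat :=
  (if j <= a then 6 * (a - j) + 1 else 6 * (j - a) - 1)%N.

Lemma pentagonal_rootE a j :
  (24 * pentagonal a j + 1 = pentagonal_root a j * pentagonal_root a j)%N.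
Proof.
have C2 s : ('C(s, 2) * 2 + s = s * s)%N.
  by elim: s => // s IHs; rewrite binS bin1; nia.
rewrite /pentagonal /pentagonal_root; case: (leqP j a) => le_ja.
  have -> : (j - a = 0)%N by lia.
  rewrite bin0n /=.
  by have := C2 (a - j)%N; move: (a - j)%N 'C(a - j, 2) => s c; nia.
have -> : (a - j = 0)%N by lia.
rewrite bin0n /=.
have ja_gt0 : (0 < j - a)%N by rewrite subn_gt0.
by have := C2 (j - a)%N; move: (j - a)%N 'C(j - a, 2) ja_gt0 => s c; nia.
Qed.

Section Theta.

Variables (A : comNzRingType) (M : nat) (y : A).
Hypothesis y0 : y ^+ M = 0.

(** Euler's pentagonal number theorem: the triple product with p = y^3, x = y
and w = y^2 runs over the three classes of exponents modulo 3. *)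
Lemma euler_pentagonal a : (M.*2 <= a)%N ->
  euler y M = \sum_(j < (a + a).+1)
                (-1) ^+ ((j - a) + (a - j)) * y ^+ pentagonal a j.
Proof.
move=> le_a.
have xw : y * y ^+ 2 = y ^+ 3 * 1 by rewrite mulr1 -exprS.
have := triple_product_nilpotent xw (nilpotentX y0 (ltn0Sn 2)) le_a le_a.
have -> : \sum_(j < (a + a).+1) tp_term (y ^+ 3) 1 (y ^+ 2) y a j
  = \sum_(j < (a + a).+1) (-1) ^+ ((j - a) + (a - j)) * y ^+ pentagonal a j.
  apply: eq_bigr => j _; rewrite /tp_term /pentagonal expr1n mul1r.
  rewrite (exprNn y) (exprNn (y ^+ 2)).
  move: (j - a)%N (a - j)%N => s t; move: 'C(s, 2) 'C(t, 2) => b c.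
  rewrite (exprD _ s t) (exprD _ (s + _)) (exprD _ s) mulnDr.
  by rewrite (exprD _ (3 * b)) (exprD _ b) -mul2n !exprM; ring.
move <-.
have M0 := nilpotent_exp_gt0 y0.
rewrite -(@euler_stable _ M y (3 * a)) //; last by lia.
rewrite -(@euler_stable _ M (y ^+ 3) a) ?nilpotentX //; last by lia.
elim: a {le_a} => [|a IHa]; first by rewrite /euler !big_ord0 !mulr1.
rewrite mulnS !addSn add0n !eulerS IHa !big_ord_recr /=.
have : y ^+ (3 * a) = (y ^+ 3) ^+ a by rewrite exprM.
by rewrite !exprSr => ->; move: ((1 * y * y * y) ^+ a) => z; ring.
Qed.

Lemma sum_around_center (F : nat -> A) a :
  \sum_(j < (a + a).+1) F j
  = F a + \sum_(s < a) (F (a + s.+1)%N + F (a - s.+1)%N).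
Proof.
rewrite -addnS big_split_ord /= big_ord_recl addn0 addrCA big_split /=.
congr (_ + _); rewrite addrC; congr (_ + _).
by rewrite (reindex_inj rev_ord_inj).
Qed.

(** The sum of (-1)^s z^(s^2) over the integers s with |s| <= a. *)
Definition theta (z : A) (a : nat) : A :=
  1 + (\sum_(s < a) (-1) ^+ s.+1 * z ^+ (s.+1 ^ 2)) *+ 2.

(** Gauss: the triple product with p = y^2 and x = w = y. *)
Lemma euler_gauss a : (M.*2 <= a)%N ->
  euler y M ^+ 2 = theta y a * euler (y ^+ 2) M.
Proof.
move=> le_a.
have xw : y * y = y ^+ 2 * 1 by rewrite mulr1.
have y20 := nilpotentX y0 (ltn0Sn 1).
have := triple_product_nilpotent xw y20 le_a le_a.
have E s : y ^+ s * (y ^+ 2) ^+ 'C(s, 2) = y ^+ (s ^ 2).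
  rewrite -exprM -exprD; congr (_ ^+ _).
  rewrite -mulnn; elim: s => // s IHs; rewrite binS bin1; nia.
rewrite sum_around_center.
have -> : tp_term (y ^+ 2) 1 y y a a = 1.
  by rewrite /tp_term subnn expr1n !mulr1.
have -> : \sum_(s < a) (tp_term (y ^+ 2) 1 y y a (a + s.+1)
                       + tp_term (y ^+ 2) 1 y y a (a - s.+1))
  = (\sum_(s < a) (-1) ^+ s.+1 * y ^+ (s.+1 ^ 2)) *+ 2.
  rewrite -sumrMnl; apply: eq_bigr => s _; rewrite tp_term_ge.
  move: (nat_of_ord s) (ltn_ord s) => {}s lt_sa.
  have -> : tp_term (y ^+ 2) 1 y y a (a - s.+1)
          = (- y) ^+ s.+1 * (y ^+ 2) ^+ 'C(s.+1, 2).
    have [r ->] : exists r, a = (r + s.+1)%N.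
      by exists (a - s.+1)%N; rewrite subnK.
    by rewrite addnK tp_term_le expr1n mul1r.
  by rewrite expr1n mul1r (exprNn y) -mulrA E mulr2n.
rewrite -/(theta y a) => <-.
have M0 := nilpotent_exp_gt0 y0.
rewrite -(@euler_stable _ M (y ^+ 2) a) //; last by lia.
rewrite -(@euler_stable _ M y a.*2) //; last by lia.
have -> : \prod_(i < a) (1 - y * (y ^+ 2) ^+ i) = odd_euler y a.
  by apply: eq_bigr => i _; rewrite -exprM mul2n -exprS.
by rewrite euler_double; ring.
Qed.

(** Jacobi: in the triple product with v = x = 'X and p = w = y, the factor
1 - 'X vanishes at 1, so the derivative at 1 is minus the product of the
remaining factors.  On the other side the terms j = a - s and j = a + 1 + s
have the same exponent and opposite signs, whence the coefficient
(a + 1 + s) - (a - s) = 2s + 1. *)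
Lemma jacobi_cube a : (M.*2 <= a)%N ->
  euler y M ^+ 3
  = \sum_(s < a.+1) (-1) ^+ s * s.*2.+1%:R * y ^+ 'C(s.+1, 2).
Proof.
move=> le_a.
have xw : 'X * y%:P = y%:P * 'X :> {poly A} by rewrite mulrC.
have yP0 : y%:P ^+ M = 0 :> {poly A} by rewrite -rmorphXn y0.
have := triple_product_nilpotent xw yP0 le_a (leq_trans le_a (leqnSn a)).
rewrite big_ord_recl expr0 mulr1.
set P := \prod_(i < a) ('X - _); set P' := \prod_(i < a) (1 - 'X * _).
have -> : euler y%:P M = (euler y M)%:P :> {poly A}.
  rewrite /euler rmorph_prod; apply: eq_bigr => i _.
  by rewrite rmorphB rmorphXn.
have P1 : P.[1] = euler y M.
  rewrite -(@euler_stable _ M y a) //; last by lia.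
  rewrite horner_prod; apply: eq_bigr => i _.
  by rewrite -exprS -rmorphXn !hornerE.
have P'1 : P'.[1] = euler y M.
  rewrite -(@euler_stable _ M y a) //; last by lia.
  rewrite horner_prod; apply: eq_bigr => i _.
  by rewrite -rmorphXn !hornerE.
have -> : (euler y M)%:P * (P * ((1 - 'X) * P'))
        = (1 - 'X) * ((euler y M)%:P * P * P') by ring.
pose F j : A := (-1) ^+ ((j - a) + (a - j))
                * y ^+ ((a - j) + 'C(j - a, 2) + 'C(a - j, 2)).
under eq_bigr => j _.
  have -> : tp_term y%:P 'X y%:P 'X a j = F j *: 'X^j.
    rewrite /tp_term exprNn (exprNn y%:P) -mul_polyC /F !exprD !rmorphM !rmorphXn.
    rewrite rmorphN rmorph1.
    have -> : 'X^j = 'X ^+ minn a j * 'X ^+ (j - a) :> {poly A}.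
      by rewrite -exprD; congr (_ ^+ _); lia.
    ring.
  over.
move/(congr1 (fun r : {poly A} => r^`().[1])).
rewrite raddf_sum horner_sum derivM hornerD !hornerM derivB derivX derivC.
rewrite !hornerE subrr mul0r addr0 {}P1 {}P'1 /= => E.
apply: oppr_inj; transitivity (- 1 * euler y M * euler y M * euler y M).
  by ring.
rewrite E {E} -[(a + a.+1).+1]addSn big_split_ord /= (reindex_inj rev_ord_inj) /=.
rewrite -big_split -sumrN; apply: eq_bigr => s _ /=.
rewrite !derivZ !derivXn !hornerZ !hornerMn !hornerXn !expr1n subSS /F.
move: (nat_of_ord s) (ltn_ord s) => {}s; rewrite ltnS => /subnKC Er.
move: (a - s)%N Er => r Er.
have -> : (r - a = 0)%N by lia.
have -> : (a - r = s)%N by lia.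
have -> : (a.+1 + s - a = s.+1)%N by lia.
have -> : (a - (a.+1 + s) = 0)%N by lia.
rewrite bin0n !addn0 add0n binS bin1 addnC -Er.
have -> : (s.*2.+1 = (s + r).+1 + s - r)%N by lia.
rewrite natrB; last by lia.
by rewrite exprS; ring.
Qed.

End Theta.

(** * Summation of the generating function *)

Section CauchySum.

Variables (A : comNzRingType) (K : nat) (y : A).
Hypothesis y0 : y ^+ K.+1 = 0.

(** This is (y; y^2)_k (y^(2k+2); y^2)_(K-k), that is, the coefficient
(a; b)_k / (b; b)_k of the q-binomial theorem for a = y and b = y^2, times the
denominator (b; b)_K. *)
Definition cauchy_coef (k : nat) : A :=
  \prod_(i < K) (if (i < k)%N then 1 - y ^+ i.*2.+1 else 1 - y ^+ i.+1.*2).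

Lemma cauchy_coef_step k : (k < K)%N ->
  (1 - y ^+ k.+1.*2) * cauchy_coef k.+1 = (1 - y ^+ k.*2.+1) * cauchy_coef k.
Proof.
move=> lt_kK; rewrite /cauchy_coef.
rewrite !(bigD1 (Ordinal lt_kK) (P := xpredT)) //= ltnSn ltnn.
rewrite [LHS]mulrCA; congr (_ * (_ * _)); apply: eq_bigr => i ne_ik.
suff -> : (i < k.+1 = (i < k))%N by [].
by move: ne_ik; rewrite -val_eqE /=; lia.
Qed.

Definition cauchy_sum (c : nat) : A :=
  \sum_(k < K.+1) (y ^+ c.*2.+1) ^+ k * cauchy_coef k.

(** The functional equation (1 - z) F(z) = (1 - a z) F(b z) of the q-binomial
series, at z = y^(2c+1), a = y and b = y^2.  The boundary term contains
z^(K+1) = 0. *)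
Lemma cauchy_sum_step c :
  (1 - y ^+ c.*2.+1) * cauchy_sum c = (1 - y ^+ c.+1.*2) * cauchy_sum c.+1.
Proof.
set z := y ^+ c.*2.+1.
have z0 : z * z ^+ K = 0 by rewrite -exprS nilpotentX.
have Ez k : (y ^+ c.+1.*2.+1) ^+ k = z ^+ k * y ^+ k.*2.
  by rewrite doubleS -addn2 exprD exprMn -!exprM mul2n.
have -> : y ^+ c.+1.*2 = z * y by rewrite doubleS exprSr.
have Ec : z * cauchy_sum c = \sum_(k < K) z ^+ k.+1 * cauchy_coef k.
  rewrite /cauchy_sum big_ord_recr mulrDr /= mulrA z0 mul0r addr0 mulr_sumr.
  by apply: eq_bigr => k _; rewrite mulrA -exprS.
have Ec1 : z * cauchy_sum c.+1
         = \sum_(k < K) z ^+ k.+1 * y ^+ k.*2 * cauchy_coef k.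
  rewrite /cauchy_sum big_ord_recr mulrDr /= Ez !mulrA z0 !mul0r addr0.
  by rewrite mulr_sumr; apply: eq_bigr => k _; rewrite Ez !mulrA -exprS.
have diff : cauchy_sum c - cauchy_sum c.+1
          = z * cauchy_sum c - z * y * cauchy_sum c.+1.
  have -> : z * y * cauchy_sum c.+1 = y * (z * cauchy_sum c.+1) by ring.
  rewrite Ec Ec1 mulr_sumr -!sumrB big_ord_recl Ez !mul1r subrr add0r.
  apply: eq_bigr => k _; rewrite -[nat_of_ord (lift ord0 k)]/k.+1 Ez.
  transitivity (z ^+ k.+1 * ((1 - y ^+ k.+1.*2) * cauchy_coef k.+1)).
    by ring.
  by rewrite cauchy_coef_step // (exprS y k.*2); ring.
transitivity (cauchy_sum c - (z * cauchy_sum c)); first by ring.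
transitivity (cauchy_sum c.+1 - (z * y * cauchy_sum c.+1)); last by ring.
apply: subr0_eq.
transitivity ((cauchy_sum c - cauchy_sum c.+1)
  - (z * cauchy_sum c - z * y * cauchy_sum c.+1)); first by ring.
by rewrite diff subrr.
Qed.

(** Iterating the functional equation from c = 0 until the argument y^(2c+1)
vanishes, where only the term of index 0 remains. *)
Lemma cauchy_sum0 :
  odd_euler y K.+1 * cauchy_sum 0 = euler (y ^+ 2) K.+1 ^+ 2.
Proof.
have iter c : odd_euler y c * cauchy_sum 0 = euler (y ^+ 2) c * cauchy_sum c.
  elim: c => [|c IHc]; first by rewrite /odd_euler /euler !big_ord0.
  rewrite /odd_euler big_ord_recr /= -/(odd_euler y c) eulerS.
  by rewrite mulrAC IHc -!mulrA -exprM mul2n -cauchy_sum_step; ring.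
rewrite iter [euler _ _ ^+ 2]expr2; congr (_ * _).
rewrite /cauchy_sum big_ord_recl expr0 mul1r big1 ?addr0.
  have y20 : y ^+ (2 * K.+1) = 0 by apply: (nilpotent_ge y0); lia.
  rewrite eulerS -exprM y20 subr0 mulr1.
  by apply: eq_bigr => i _; rewrite -exprM mul2n.
by move=> k _; rewrite -exprM (nilpotent_ge y0) ?mul0r //= [bump _ _]add1n; lia.
Qed.

Lemma cauchy_sum_euler G : euler y K.+1 * G = cauchy_sum 0 ->
  euler y K.+1 ^+ 2 * G = euler (y ^+ 2) K.+1 ^+ 3.
Proof.
move=> EG; rewrite expr2 -{1}(@euler_stable _ K.+1 y K.+1.*2) //; last by lia.
by rewrite euler_double -mulrA EG -mulrA cauchy_sum0 -exprS.
Qed.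

End CauchySum.

(** * Counting partitions by multiplicities *)

(** The multiplicities c of the part i that are possible in a partition counted
by [EObar] whose largest even part is 2k; k = 0 stands for no even part. *)
Definition allowed (k i c : nat) : bool :=
  if i == 0 then c == 0
  else if odd i then (if (i < k.*2)%N then c == 0 else ~~ odd c)
  else if (i < k.*2)%N then ~~ odd c
  else if i == k.*2 then odd c else c == 0.

Section Allowed.
Local Open Scope nat_scope.

Lemma largest_even_mem s : 0 < largest_even s -> largest_even s \in s.
Proof.
rewrite /largest_even -big_filter => pos.
have : \max_(i <- [seq i <- s | ~~ odd i]) i \in [seq i <- s | ~~ odd i].
  move: pos; elim: [seq i <- s | ~~ odd i] => [|p r IHr]; first by rewrite big_nil.
  rewrite big_cons inE; case: (leqP p (\max_(j <- r) j)) => [le_p pos | //].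
    by rewrite IHr ?orbT.
  by rewrite eqxx.
by rewrite mem_filter => /andP[].
Qed.

Lemma largest_even_ge s p : p \in s -> ~~ odd p -> p <= largest_even s.
Proof. by move=> ps ev; rewrite /largest_even (leq_bigmax_seq p). Qed.

Lemma largest_even_even s : ~~ odd (largest_even s).
Proof.
by rewrite /largest_even; elim/big_ind: _ => // a b; case: (leqP a b).
Qed.

(** Once the largest even part is known, the condition on a partition is a
condition on each multiplicity separately: this is what makes the generating
function a sum of products. *)
Lemma EObar_cond_allowed s k : 0 \notin s ->
  reflect (forall i, allowed k i (count_mem i s))
          (EObar_cond s && (largest_even s == k.*2)).
Proof.
move=> s0; have cnt i : (count_mem i s == 0) = (i \notin s).
  by rewrite -leqn0 leqNgt -has_count has_pred1.
apply: (iffP andP) => [[/andP[/allrelP EO /allP par] /eqP L] i | all_i].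
  have Lmem : 0 < k -> k.*2 \in s.
    by rewrite -L => k0; apply: largest_even_mem; rewrite L double_gt0.
  have EO' p r : p \in s -> r \in s -> ~~ odd p -> odd r -> p < r.
    by move=> ps rs ev od; apply: EO; rewrite mem_filter ?ev ?od.
  have even_count : i \in s -> i != k.*2 -> ~~ odd (count_mem i s).
    by move=> i_s /negPf ne; have /eqP := par i i_s; rewrite L ne => ->.
  rewrite /allowed; case: eqP => [-> | /eqP i0]; first by rewrite cnt.
  have [i_s | i_s] := boolP (i \in s); last first.
    have /eqP -> : count_mem i s == 0 by rewrite cnt.
    case: ifP => _; case: ifP => // _; case: eqP => //= Ei.
    by move: i_s; rewrite Ei Lmem //; move: i0; rewrite Ei; case: (k).
  have [od | ev] := boolP (odd i).
    case: ltnP => lt_i.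
      have k0 : 0 < k by lia.
      by have := EO' _ _ (Lmem k0) i_s; rewrite odd_double od; lia.
    by apply: even_count => //; lia.
  have le_i := largest_even_ge i_s ev; rewrite L in le_i.
  case: ltnP => lt_i; first by apply: even_count => //; lia.
  have -> : i = k.*2 by lia.
  rewrite eqxx; have -> : k.*2 = i by lia.
  by have /eqP -> := par i i_s; rewrite L; lia.
have pos i : i \in s -> (count_mem i s == 0) = false by rewrite cnt => ->.
have nz i : i \in s -> (i == 0) = false.
  by move=> i_s; apply: contraNF s0 => /eqP <-.
have le_even i : i \in s -> ~~ odd i -> i <= k.*2.
  move=> i_s ev; have := all_i i; rewrite /allowed nz // (negPf ev) pos //.
  by case: ltngtP.
have ge_odd i : i \in s -> odd i -> k.*2 < i.
  move=> i_s od; have := all_i i; rewrite /allowed nz // od pos //.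
  by case: ltnP => //; lia.
have L : largest_even s = k.*2.
  apply/eqP; rewrite eqn_leq; apply/andP; split.
    by apply/bigmax_leqP_seq => i i_s ev; apply: le_even.
  case: (posnP k) => [-> // | k0]; apply: largest_even_ge; rewrite ?odd_double //.
  have := all_i k.*2; rewrite /allowed odd_double ltnn eqxx double_eq0.
  rewrite gtn_eqF //; apply: contraTT => ks.
  by have /eqP -> : count_mem k.*2 s == 0 by rewrite cnt.
split; last by rewrite L.
apply/andP; split.
  apply/allrelP => p r; rewrite !mem_filter => /andP[ev ps] /andP[od rs].
  exact: leq_ltn_trans (le_even _ ps ev) (ge_odd _ rs od).
apply/allP => i i_s; rewrite L; have := all_i i; rewrite /allowed nz // pos //.
have [od | ev] := boolP (odd i).
  by rewrite gtn_eqF ?ge_odd // ltnNge ltnW ?ge_odd //= eqbF_neg.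
by have := le_even _ i_s ev; case: ltngtP => // _ _; rewrite ?eqbF_neg ?eqb_id.
Qed.

End Allowed.

Section Multiplicities.
Local Open Scope nat_scope.
Variable n : nat.
Local Notation mult := {ffun 'I_n.+1 -> 'I_n.+1}.

Definition partition_of (m : mult) : seq nat :=
  sort geq (flatten [seq nseq (m i) (val i) | i <- enum 'I_n.+1]).

Lemma count_partition_of (m : mult) (i : 'I_n.+1) :
  count_mem (val i) (partition_of m) = m i.
Proof.
rewrite count_sort count_flatten sumnE !big_map /=.
rewrite (bigD1 i) //= count_nseq /= eqxx mul1n big1 ?addn0 // => j ne_ji.
by rewrite count_nseq /= (inj_eq val_inj) (negPf ne_ji).
Qed.

Lemma sumn_partition_of (m : mult) :
  sumn (partition_of m) = \sum_(i < n.+1) i * m i.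
Proof.
rewrite (perm_sumn (permEl (perm_sort _ _))) sumn_flatten sumnE !big_map.
by apply: eq_bigr => i _; rewrite sumn_nseq.
Qed.

Lemma mem_partition_of (m : mult) p : p \in partition_of m -> p < n.+1.
Proof.
rewrite mem_sort => /flattenP[_ /mapP[i _ ->]].
by rewrite mem_nseq => /andP[_ /eqP ->]; apply: ltn_ord.
Qed.

Lemma sorted_partition_of (m : mult) : sorted geq (partition_of m).
Proof. by apply: sort_sorted => a b; apply: leq_total. Qed.

(** The partitions counted by [EObar n] with largest even part 2k, through
their multiplicities. *)
Definition EO_mults (k : nat) : {set mult} :=
  [set m : mult | (m \in family (fun i : 'I_n.+1 => [pred c | allowed k i (val c)]))
     && (\sum_(i < n.+1) i * m i == n)].

Lemma EObar_mults : EObar n = \sum_(k < n./2.+1) #|EO_mults k|.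
Proof.
pose S : {set 'I_n./2.+1 * mult} := 
  [set x : 'I_n./2.+1 * mult | x.2 \in EO_mults x.1].
have -> : \sum_(k < n./2.+1) #|EO_mults k| = #|S|.
  under eq_bigr do rewrite -sum1_card.
  by rewrite pair_big_dep -sum1_card; apply: eq_bigl => x; rewrite !inE.
have count_ge (m : mult) i : n < i -> count_mem i (partition_of m) = 0.
  move=> lt_ni; apply/eqP; rewrite -leqn0 leqNgt -has_count has_pred1.
  by apply/negP => /mem_partition_of; rewrite ltnNge lt_ni.
have okP k (m : mult) : k <= n./2 -> m \in EO_mults k ->
  [&& is_partition n (partition_of m), EObar_cond (partition_of m)
    & largest_even (partition_of m) == k.*2].
  move=> le_k; rewrite inE => /andP[/familyP mk /eqP sum_m].
  have cnt i (lt_in : i < n.+1) : count_mem i (partition_of m) = m (Ordinal lt_in).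
    exact: (count_partition_of m (Ordinal lt_in)).
  have s0 : 0 \notin partition_of m.
    rewrite -has_pred1 has_count -leqNgt leqn0 (cnt 0 (ltn0Sn n)).
    exact: (mk (Ordinal (ltn0Sn n))).
  apply/andP; split.
    by apply/and3P; rewrite sorted_partition_of s0 sumn_partition_of sum_m.
  apply/(EObar_cond_allowed _ s0) => i.
  have [le_in | lt_ni] := leqP i n.
    by rewrite (cnt i le_in); have := mk (Ordinal (le_in : i < n.+1)); rewrite inE.
  rewrite count_ge // /allowed gtn_eqF /=; last by lia.
  case: ifP => _; case: ifP => // _; rewrite gtn_eqF //; lia.
rewrite cardE -(size_map (fun x => partition_of x.2)).
apply: EObar_enum.
  rewrite map_inj_in_uniq ?enum_uniq // => -[k m] [k' m'].
  rewrite !mem_enum ![_ \in S]inE /= => /okP /= /(_ (ltn_ord k)).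
  case/and3P => _ _ /eqP Lk /okP /= /(_ (ltn_ord k')) /and3P[_ _ /eqP Lk'] E.
  congr (_, _).
    by apply: val_inj; apply: double_inj; rewrite -Lk -Lk' E.
  apply/ffunP => i; apply: val_inj.
  by rewrite -[LHS]count_partition_of -[RHS]count_partition_of E.
move=> s; apply/mapP/andP => [[[k m]] | [Ps Cs]].
  rewrite mem_enum ![_ \in S]inE /= => /okP /= /(_ (ltn_ord k)).
  by case/and3P => Ps Cs _ ->.
have s0 : 0 \notin s by case/and3P: Ps.
have le_L : largest_even s <= n.
  case: (posnP (largest_even s)) => [-> // | /largest_even_mem].
  exact: part_le.
pose k := (largest_even s)./2.
have Lk : largest_even s = k.*2.
  by rewrite -[LHS]odd_double_half (negPf (largest_even_even s)).
have lt_k : k < n./2.+1 by rewrite ltnS half_leq.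
have /(EObar_cond_allowed _ s0) ok : EObar_cond s && (largest_even s == k.*2).
  by rewrite Cs Lk eqxx.
pose m : mult := [ffun i : 'I_n.+1 => inord (count_mem (val i) s)].
have mE i : m i = count_mem (val i) s :> nat.
  rewrite ffunE inordK // ltnS (leq_trans (count_size _ _)) //.
  exact: size_partition.
have sE : s = partition_of m.
  apply: (@sorted_eq _ geq).
  - by move=> b a c /= ab bc; apply: leq_trans bc ab.
  - by move=> a b /= /andP[ba ab]; apply/eqP; rewrite eqn_leq ab ba.
  - by case/and3P: Ps.
  - exact: sorted_partition_of.
  apply/allP => i _; apply/eqP => /=; have [le_in | lt_ni] := leqP i n.
    by rewrite (count_partition_of m (Ordinal (le_in : i < n.+1))) mE.
  rewrite count_ge //; apply/eqP; rewrite -leqn0 leqNgt -has_count has_pred1.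
  by apply/negP => /(part_le Ps); rewrite leqNgt lt_ni.
exists (Ordinal lt_k, m) => //.
rewrite mem_enum !inE; apply/andP; split.
  by apply/familyP => i /=; rewrite inE mE; apply: ok.
by rewrite -sumn_partition_of -sE; case/and3P: Ps.
Qed.

End Multiplicities.

(** * The generating function *)

(** The correction [odd m] in the exponent rounds m up to an even number. *)
Lemma geometric_even (A : comNzRingType) (z : A) m :
  (1 - z ^+ 2) * (\sum_(j < m | ~~ odd j) z ^+ j) = 1 - z ^+ (m + odd m).
Proof.
rewrite big_mkcond; elim: m => [|m IHm].
  by rewrite big_ord0 addn0 subrr mulr0.
rewrite big_ord_recr mulrDr IHm /=; case: (odd m) => /=.
  by rewrite mulr0 addr0 addn1 addn0.
by rewrite addn0 addn1 !exprS; ring.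
Qed.

Lemma geometric_odd (A : comNzRingType) (z : A) m :
  (1 - z ^+ 2) * (\sum_(j < m | odd j) z ^+ j) = z - z ^+ (m + ~~ odd m).
Proof.
rewrite big_mkcond; elim: m => [|m IHm].
  by rewrite big_ord0 add0n expr1 subrr mulr0.
rewrite big_ord_recr mulrDr IHm /=; case: (odd m) => /=.
  by rewrite addn0 addn1 !exprS; ring.
by rewrite mulr0 addr0 addn1 addn0.
Qed.

Lemma prod_double (A : comNzRingType) (h : nat -> A) m :
  \prod_(i < m.*2) h i = \prod_(i < m) (h i.*2 * h i.*2.+1).
Proof.
elim: m => [|m IHm]; first by rewrite !big_ord0.
by rewrite doubleS !big_ord_recr /= IHm mulrA.
Qed.

Section GeneratingFunction.

Variables (A : comNzRingType) (N : nat) (q : A).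
Hypothesis q0 : q ^+ N.*2.+1 = 0.

Local Notation n := N.*2.
Local Notation y := (q ^+ 2).

Definition part_series (k i : nat) : A :=
  \sum_(j < n.+1 | allowed k i j) q ^+ (i * j).

Definition EObar_series : A :=
  \sum_(k < N.+1) \prod_(i < n.+1) part_series k i.

(** Expanding the product of the [part_series] yields one monomial for each
choice of allowed multiplicities. *)
Lemma EObar_seriesP (R : comNzRingType) (cf : {additive A -> R}) :
  (forall e, cf (q ^+ e) = (e == n)%:R) -> cf EObar_series = (EObar n)%:R.
Proof.
move=> cfq; rewrite EObar_mults doubleK natr_sum raddf_sum.
apply: eq_bigr => k _; rewrite /part_series bigA_distr_big_dep raddf_sum.
rewrite -sum1_card natr_sum.
under [RHS]eq_bigl do rewrite inE.
rewrite big_mkcondr; apply: eq_bigr => m _.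
by rewrite prodrXr cfq; case: eqP.
Qed.

Lemma y_nilpotent : y ^+ N.+1 = 0.
Proof. by rewrite -exprM (nilpotent_ge q0) //; lia. Qed.

(** The factor 1 - y^i of the Euler product clears the denominator of the i-th
series, since y^i = (q^i)^2 and a multiplicity of prescribed parity yields a
geometric series in (q^i)^2. *)
Lemma part_series_euler k i :
  (1 - y ^+ i.+1) * part_series k i.+1
  = if odd i.+1 then (if (i.+1 < k.*2)%N then 1 - y ^+ i.+1 else 1)
    else if (i.+1 < k.*2)%N then 1
    else if i.+1 == k.*2 then y ^+ k else 1 - y ^+ i.+1.
Proof.
set z := q ^+ i.+1.
have Ez : y ^+ i.+1 = z ^+ 2 by rewrite exprAC.
have z0 m : (n < m)%N -> z ^+ m = 0.
  by move=> lt_nm; apply: (nilpotent_ge _ lt_nm); apply: nilpotentX.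
have even_series : (1 - z ^+ 2) * (\sum_(j < n.+1 | ~~ odd j) z ^+ j) = 1.
  by rewrite geometric_even z0 ?subr0 //; lia.
have odd_series : (1 - z ^+ 2) * (\sum_(j < n.+1 | odd j) z ^+ j) = z.
  by rewrite geometric_odd z0 ?subr0 //; lia.
have zero_series : \sum_(j < n.+1 | j == 0 :> nat) z ^+ j = 1.
  by rewrite (big_pred1 ord0) // => j; rewrite -val_eqE.
rewrite Ez /part_series /allowed; under eq_bigr do rewrite exprM -/z.
case: (odd i.+1); case: ifP => _ //=; rewrite ?zero_series ?mulr1 //.
case: eqP => [Ei | _]; rewrite ?zero_series ?mulr1 //.
by rewrite odd_series /z Ei -mul2n exprM.
Qed.

Lemma part_series0 k : part_series k 0 = 1.
Proof.
by rewrite /part_series (big_pred1 ord0) ?mul0n // => j; rewrite -val_eqE.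
Qed.

Lemma parts_euler k : (k <= N)%N ->
  euler y N.+1 * \prod_(i < n.+1) part_series k i = y ^+ k * cauchy_coef N y k.
Proof.
move=> le_kN.
have -> : euler y N.+1 = euler y n.
  rewrite -(@euler_stable _ N.+1 y n.+1) ?y_nilpotent //; last by lia.
  by rewrite eulerS (nilpotent_ge y_nilpotent) ?subr0 ?mulr1 //; lia.
rewrite big_ord_recl part_series0 mul1r /euler -big_split /=.
under eq_bigr do rewrite part_series_euler.
rewrite (prod_double (fun i =>
  if odd i.+1 then (if (i.+1 < k.*2)%N then 1 - y ^+ i.+1 else 1)
    else if (i.+1 < k.*2)%N then 1
    else if i.+1 == k.*2 then y ^+ k else 1 - y ^+ i.+1)).
have Ek : y ^+ k = \prod_(i < N) (if i.+1 == k then y ^+ k else 1).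
  case: k le_kN => [|k] lt_kN; first by rewrite big1.
  rewrite (bigD1 (Ordinal lt_kN)) //= eqxx big1 ?mulr1 // => i.
  by rewrite eqSS -val_eqE => /negPf ->.
rewrite [in RHS]Ek /cauchy_coef -big_split /=; apply: eq_bigr => i _.
rewrite odd_double /= -doubleS ltn_double (inj_eq double_inj).
have -> : (i.*2.+1 < k.*2 = (i < k))%N by lia.
case: (ltngtP i.+1 k) => [_ | _ | <-].
- by rewrite mul1r mulr1.
- by [].
- by rewrite mulrC.
Qed.

(** The generating function f_2^3 / f_1^2. *)
Lemma EObar_series_euler :
  euler y N.+1 ^+ 2 * EObar_series = euler (y ^+ 2) N.+1 ^+ 3.
Proof.
apply: cauchy_sum_euler; first exact: y_nilpotent.
rewrite /EObar_series mulr_sumr; apply: eq_bigr => k _.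
by rewrite expr1 parts_euler // -ltnS.
Qed.

End GeneratingFunction.

(** * Divisibility by 5 *)

Section Triangular.
Local Open Scope nat_scope.

(** The equation is (2s+1)^2 + 2 (2t+1)^2 = 8N + 3 = 0 modulo 5, and -2 is not
a square modulo 5. *)
Lemma triangular_5 N s t r : N %% 5 = 4 ->
  'C(s.+1, 2) + 2 * 'C(t.+1, 2) + 5 * r = N -> 5 %| s.*2.+1.
Proof.
move=> N4 E.
have C2 i : ('C(i.+1, 2) * 2 = i * i + i)%N.
  by elim: i => // i IHi; rewrite binS bin1 mulnDl IHi; lia.
have {E} : s * s + s + 2 * (t * t + t) + 10 * r = 2 * N.
  by rewrite -!C2 -E; lia.
rewrite (divn_eq s 5) (divn_eq t 5) (divn_eq N 5) N4.
move: (s %/ 5) (t %/ 5) (N %/ 5) => a b c.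
have : s %% 5 < 5 by rewrite ltn_mod.
have : t %% 5 < 5 by rewrite ltn_mod.
move: (s %% 5) (t %% 5) => u v.
case: v => [|[|[|[|[|v]]]]] // _; case: u => [|[|[|[|[|u]]]]] // _; nia.
Qed.

End Triangular.

Section Modulo5.

Variables (A R : comNzRingType) (N : nat) (q : A) (cf : {additive A -> R}).
Hypothesis q0 : q ^+ N.*2.+1 = 0.
Hypothesis cfq : forall e, cf (q ^+ e) = (e == N.*2)%:R.
Hypothesis A5 : 5%:R = 0 :> A.

Local Notation y := (q ^+ 2).
Local Notation M := N.+1.

Lemma euler_exp5 m : euler y m ^+ 5 = euler (y ^+ 5) m.
Proof.
rewrite /euler -prodrXl; apply: eq_bigr => i _; rewrite (exprAC _ 5).
move: (y ^+ i.+1) => z.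
transitivity (1 - z ^+ 5 + 5%:R * (- z + 2%:R * z ^+ 2 - 2%:R * z ^+ 3 + z ^+ 4)).
  by ring.
by rewrite A5 mul0r addr0.
Qed.

(** Dividing by a series in y^5 does not change which residues modulo 5 occur
as exponents.  The statement allows all shifts by y^(5r), because cancelling
1 - y^(5i) moves the coefficient in question by 5i; after finitely many such
moves it is zero by nilpotency. *)
Lemma support_euler_exp5 m z :
  (forall r, cf (euler (y ^+ 5) m * z * y ^+ (5 * r)) = 0) ->
  forall r, cf (z * y ^+ (5 * r)) = 0.
Proof.
elim: m z => [|m IHm] z; first by rewrite /euler big_ord0 mul1r.
rewrite eulerS -mulrA => /IHm {IHm} zr r.
have shift k : cf (z * y ^+ (5 * r)) = cf (z * y ^+ (5 * (r + k * m.+1))).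
  elim: k => [|k ->]; first by rewrite addn0.
  apply: subr0_eq; rewrite -raddfB -[RHS](zr (r + k * m.+1)%N); congr (cf _).
  rewrite (mulSn k) (addnC m.+1) addnA (mulnDr _ (r + _)) exprD (exprM y 5 m.+1).
  by ring.
rewrite (shift N.+1) (nilpotent_ge (y_nilpotent q0)) ?mulr0 ?raddf0 //; lia.
Qed.

Lemma cf_monomial s m e : cf (q ^+ e) = 0 -> cf ((-1) ^+ s * m%:R * q ^+ e) = 0.
Proof.
by move=> e0; rewrite -mulrA raddfMsign mulr_natl raddfMn e0 mul0rn mulr0.
Qed.

Lemma EObar_series_5 : (N %% 5 = 4)%N -> cf (EObar_series N q) = 0.
Proof.
move=> N4; rewrite -[EObar_series N q]mulr1 -[1](expr0 y) -(muln0 5).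
apply: (@support_euler_exp5 M) => r.
rewrite -euler_exp5 (exprD _ 3 2) -(mulrA (_ ^+ 3)) (EObar_series_euler q0).
rewrite (jacobi_cube (y_nilpotent q0) (leqnn _)).
rewrite (jacobi_cube (nilpotentX (y_nilpotent q0) (ltn0Sn 1)) (leqnn _)).
rewrite mulr_suml mulr_suml raddf_sum big1 // => s _.
rewrite mulr_sumr mulr_suml raddf_sum big1 // => t _ /=.
have -> : (-1) ^+ s * s.*2.+1%:R * y ^+ 'C(s.+1, 2) *
    ((-1) ^+ t * t.*2.+1%:R * (y ^+ 2) ^+ 'C(t.+1, 2)) * y ^+ (5 * r)
  = (-1) ^+ (s + t) * (s.*2.+1 * t.*2.+1)%:R
    * q ^+ (2 * ('C(s.+1, 2) + 2 * 'C(t.+1, 2) + 5 * r)).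
  rewrite (exprM q 2) (exprD _ (_ + _)) (exprD _ 'C(s.+1, 2)) (exprM y 2).
  by rewrite (exprD _ s t) natrM; ring.
have [E | neN] := eqVneq ('C(s.+1, 2) + 2 * 'C(t.+1, 2) + 5 * r)%N N.
  have /dvdnP[k ->] := triangular_5 N4 E.
  by rewrite !natrM A5 mulr0 mul0r mulr0 mul0r raddf0.
rewrite cf_monomial // cfq; case: eqP => // E2.
by case/eqP: neN; move: E2; set E := (_ + 5 * r)%N; lia.
Qed.

End Modulo5.

Lemma EObar_dvd5 N : (N %% 5 = 4)%N -> (5 %| EObar N.*2)%N.
Proof.
move=> N4; have [A [q [cf [q0 cfq An]]]] := truncated_series_ring 'Z_5 N.*2.
have := EObar_seriesP cfq; rewrite (EObar_series_5 q0 cfq) //.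
  by move/(congr1 (@nat_of_ord _)); rewrite val_Zp_nat // => /esym/eqP.
by apply: An; apply: val_inj.
Qed.

(** * Parity of the representations by a binary form *)

Section Form.
Local Open Scope nat_scope.

(** The orbits are pairs: remove x and f x and proceed by induction. *)
Lemma even_size_involution (T : eqType) (f : T -> T) (s : seq T) : uniq s ->
  (forall x, x \in s -> [/\ f x \in s, f (f x) = x & f x != x]) ->
  ~~ odd (size s).
Proof.
have [m] := ubnP (size s); elim: m s => // m IHm [|x s] //=.
rewrite ltnS => le_sm /andP[xs us] fs.
have [fx ffx nfx] := fs x (mem_head x s).
have fx_s : f x \in s by move: fx; rewrite inE (negPf nfx).
have sz := size_rem fx_s.
have s_gt0 : 0 < size s by case: (s) fx_s.
rewrite -(prednK s_gt0) /= negbK -sz; apply: IHm.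
- by rewrite sz; lia.
- exact: rem_uniq.
move=> z; rewrite !mem_rem_uniq // !inE => /andP[zfx zs].
have [fz ffz nfz] := fs z (mem_behead (s := x :: s) zs).
split=> //; apply/andP; split.
  by apply: contraNneq xs => E; rewrite -ffx -E ffz.
move: fz; rewrite inE => /predU1P[E|//].
by rewrite -E ffz eqxx in zfx.
Qed.

(** If P is a prime above 5 that divides X + Y sqrt(-6), then
P^2 = (1 + 2 sqrt(-6)) or its conjugate, and replacing P by its conjugate is
the multiplication by (1 - 2 sqrt(-6)) / 5 or (1 + 2 sqrt(-6)) / 5.  The two
cases according to P are told apart by X = -2Y or X = 2Y modulo 5.  Absolute
values, written as sums of truncated differences, make the result positive. *)
Definition form_involution (x : nat * nat) : nat * nat :=
  let: (X, Y) := x in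
  if 5 %| X + 2 * Y
  then ((X + 12 * Y) %/ 5, (2 * X - Y + (Y - 2 * X)) %/ 5)
  else ((X - 12 * Y + (12 * Y - X)) %/ 5, (2 * X + Y) %/ 5).

Arguments form_involution : simpl never.

Definition on_form (D : nat) (x : nat * nat) : bool :=
  (0 < x.2) && (x.1 * x.1 + 6 * (x.2 * x.2) == D).

Lemma form_mod5 X Y : 5 %| X * X + 6 * (Y * Y) -> ~~ (5 %| X + 2 * Y) ->
  X %% 5 = (2 * Y) %% 5.
Proof.
rewrite (divn_eq X 5) (divn_eq Y 5).
move: (X %/ 5) (Y %/ 5) => a b.
have : X %% 5 < 5 by rewrite ltn_mod.
have : Y %% 5 < 5 by rewrite ltn_mod.
move: (X %% 5) (Y %% 5) => u v.
case: v => [|[|[|[|[|v]]]]] // _; case: u => [|[|[|[|[|u]]]]] // _; nia.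
Qed.

(** As 5 divides D exactly once, 5 divides neither X nor Y, and X = 2Y or
X = -2Y modulo 5 but not both.  A fixed point would satisfy X = 3Y or X = 2Y,
hence D = 15 Y^2 or D = 10 Y^2, which D = 1 modulo 6 excludes. *)
Lemma form_involutionP D x : 5 %| D -> ~~ (25 %| D) -> D %% 6 = 1 ->
  on_form D x ->
  [/\ on_form D (form_involution x), form_involution (form_involution x) = x
    & form_involution x != x].
Proof.
case: x => X Y D5 D25 D6.
have nX5 X' Y' : X' * X' + 6 * (Y' * Y') = D -> 5 %| X' -> ~~ (5 %| Y').
  move=> E /dvdnP[k Ek]; apply: contra D25 => /dvdnP[l El].
  by rewrite -E Ek El; apply/dvdnP; exists (k * k + 6 * (l * l)); ring.
rewrite /on_form /=.
(* Writing 5u for X + 2Y or for |X - 2Y|, whichever 5 divides, and a, b for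
   the ordinates of a point and of its image, either a + b = 2u or
   |a - b| = 2u; the rules below are the possible arrangements. *)
have plus u a b : a + b = 2 * u ->
    form_involution (u + 2 * b, a) = (u + 2 * a, b).
  move=> ab; rewrite /form_involution.
  have -> : u + 2 * b + 2 * a = 5 * u by lia.
  by rewrite dvdn_mulr //; congr (_, _); lia.
have plus_minus u a b : a = b + 2 * u -> 2 * b <= u ->
    form_involution (u - 2 * b, a) = (u + 2 * a, b).
  move=> ab le_bu; rewrite /form_involution.
  have -> : u - 2 * b + 2 * a = 5 * u by lia.
  by rewrite dvdn_mulr //; congr (_, _); lia.
have minus_minus u a b : a = b + 2 * u -> u <= 2 * b ->
    ~~ (5 %| 2 * b - u + 2 * a) ->
    form_involution (2 * b - u, a) = (u + 2 * a, b).
  move=> ab le_bu; rewrite /form_involution => /negPf ->.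
  by congr (_, _); lia.
have minus u a b : a = b + 2 * u -> ~~ (5 %| u + 2 * a + 2 * b) ->
    form_involution (u + 2 * a, b) = (u - 2 * b + (2 * b - u), a).
  move=> ab; rewrite /form_involution => /negPf ->.
  by congr (_, _); lia.
have minus_norm u b a : a = b + 2 * u ->
    (u - 2 * b + (2 * b - u)) * (u - 2 * b + (2 * b - u)) + 6 * (a * a)
    = (u + 2 * a) * (u + 2 * a) + 6 * (b * b).
  move=> ->; case: (leqP (2 * b) u) => [/subnK | /ltnW/subnK] le.
    by rewrite -le addnK; have -> : 2 * b - (u - 2 * b + 2 * b) = 0 by [lia]; ring.
  have [w Ew] : exists w, 2 * b = w + u by exists (2 * b - u).
  have -> : u - 2 * b + (2 * b - u) = w by lia.
  nia.
case/andP=> Y0 /eqP DE.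
have [/dvdnP[u Eu] | n5] := boolP (5 %| X + 2 * Y).
  have [le_Yu | lt_uY] := leqP Y (2 * u).
    pose b := 2 * u - Y; have Eb : Y + b = 2 * u by rewrite /b; lia.
    have EX : X = u + 2 * b by lia.
    have b0 : 0 < b.
      rewrite lt0n; apply: contraNneq D25 => b0; apply/dvdnP; exists (u * u).
      have EY : Y = 2 * u by lia.
      have EX' : X = u by lia.
      by rewrite -DE EY EX'; ring.
    have DE' : (u + 2 * Y) * (u + 2 * Y) + 6 * (b * b) = D.
      by rewrite -DE EX; move: Eb; clear; nia.
    have Eb' : b + Y = 2 * u by rewrite addnC.
    rewrite EX (plus _ _ _ Eb) (plus _ _ _ Eb') /= b0 DE' eqxx; split=> //.
    apply/eqP => -[_ Eba]; have : D %% 3 = 1 by lia.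
    rewrite -DE'.
    have -> : Y = u by lia.
    have -> : b = u by lia.
    have -> : (u + 2 * u) * (u + 2 * u) + 6 * (u * u) = (5 * u * u) * 3 by ring.
    by rewrite modnMl.
  pose b := Y - 2 * u; have Eb : Y = b + 2 * u by rewrite /b; lia.
  have EX : X = u - 2 * b by lia.
  have le_bu : 2 * b <= u by lia.
  have b0 : 0 < b by rewrite /b; lia.
  have DE' : (u + 2 * Y) * (u + 2 * Y) + 6 * (b * b) = D.
    by rewrite -(minus_norm u b Y Eb) -DE EX; have -> : 2 * b - u = 0; [lia | rewrite addn0].
  have nb : ~~ (5 %| u + 2 * Y + 2 * b).
    by apply/negP => n5; have /negP[] := nX5 _ _ DE' ltac:(lia); lia.
  rewrite EX plus_minus // minus //= b0 DE' eqxx; split=> //.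
    by congr (_, _); lia.
  by apply/eqP => -[_ Eba]; lia.
have X2Y : X %% 5 = (2 * Y) %% 5 by apply: form_mod5 => //; rewrite DE.
have [le_YX | lt_XY] := leqP (2 * Y) X.
  have [u Eu] : exists u, X = 2 * Y + 5 * u.
    by exists ((X - 2 * Y) %/ 5); lia.
  have [a Ea] : exists a, a = Y + 2 * u by exists (Y + 2 * u).
  have EX : X = u + 2 * a by lia.
  have DE' := minus_norm u Y a Ea; rewrite -EX DE in DE'.
  rewrite EX minus -?EX //=; split.
  - by rewrite DE' eqxx andbT; lia.
  - have [le_Yu | lt_uY] := leqP (2 * Y) u.
      have -> : u - 2 * Y + (2 * Y - u) = u - 2 * Y by lia.
      by rewrite plus_minus // -EX.
    have E0 : u - 2 * Y + (2 * Y - u) = 2 * Y - u by lia.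
    rewrite E0 minus_minus -?EX //; first by lia.
    rewrite E0 in DE'; apply/negP => n5'.
    by have /negP[] := nX5 _ _ DE' ltac:(lia); lia.
  - apply/eqP => -[_ EaY]; have /eqP := D6; rewrite -DE.
    have -> : X = 2 * Y by lia.
    by have -> : 2 * Y * (2 * Y) + 6 * (Y * Y) = 10 * (Y * Y); [ring | lia].
have [u Eu] : exists u, X + 5 * u = 2 * Y.
  by exists ((2 * Y - X) %/ 5); lia.
have [b Eb] : exists b, Y = b + 2 * u by exists (Y - 2 * u); lia.
have EX : X = 2 * b - u by lia.
have le_ub : u <= 2 * b by lia.
have DE' : (u + 2 * Y) * (u + 2 * Y) + 6 * (b * b) = D.
  rewrite -(minus_norm u b Y Eb) -DE EX.
  by have -> : u - 2 * b = 0; [lia | rewrite add0n].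
have nb : ~~ (5 %| u + 2 * Y + 2 * b).
  by apply/negP => n5'; have /negP[] := nX5 _ _ DE' ltac:(lia); lia.
rewrite EX minus_minus -?EX // minus //= DE' eqxx; split.
- by rewrite andbT; lia.
- by congr (_, _); lia.
by apply/eqP => -[E1 E2]; lia.
Qed.
End Form.

(** * Divisibility by 4 *)

Section Representations.
Local Open Scope nat_scope.

Lemma pentagonal_root_inj a j j' :
  pentagonal_root a j = pentagonal_root a j' -> j = j'.
Proof.
by rewrite /pentagonal_root; case: (leqP j a) => ?; case: (leqP j' a) => ?; lia.
Qed.

(** X^2 = 1 modulo 6, so X is 6k + 1 or 6k - 1. *)
Lemma pentagonal_root_surj a X N Y : X * X + 6 * (Y * Y) = 6 * N + 1 -> N <= a ->
  exists2 j, j <= a + a & pentagonal_root a j = X.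
Proof.
move=> E le_Na; have le_X : X <= 6 * N + 1 by nia.
have : X %% 6 = 1 \/ X %% 6 = 5.
  have : X %% 6 < 6 by rewrite ltn_mod.
  move: E; rewrite {1 2}(divn_eq X 6); move: (X %/ 6) (X %% 6) => c r.
  by case: r => [|[|[|[|[|[|r]]]]]] // E _; (try by left); (try by right); nia.
case=> E1.
  by exists (a - X %/ 6); rewrite /pentagonal_root ?ifT; lia.
exists (a + (X %/ 6).+1); first by lia.
by rewrite /pentagonal_root ifF; lia.
Qed.

(** Multiplying by 6 and adding 1 turns s^2 + 4 (pentagonal number) = N into
X^2 + 6 Y^2 = 6N + 1. *)
Lemma even_representations N a : N <= a ->
  5 %| 6 * N + 1 -> ~~ (25 %| 6 * N + 1) ->
  ~~ odd #|[set x : 'I_a.+1 * 'I_(a + a).+1 |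
             x.1.+1 * x.1.+1 + 4 * pentagonal a x.2 == N]|.
Proof.
move=> le_Na D5 D25; set P := [set _ | _].
pose h (x : 'I_a.+1 * 'I_(a + a).+1) := (pentagonal_root a x.2, (x.1 : nat).+1).
have h_inj : injective h.
  move=> [s j] [s' j'] [/pentagonal_root_inj Ej Es].
  by congr (_, _); apply: val_inj.
have memP x : (x \in P) = on_form (6 * N + 1) (h x).
  by rewrite inE /on_form /= -pentagonal_rootE; lia.
rewrite cardE -(size_map h); apply: (@even_size_involution _ form_involution).
  by rewrite map_inj_uniq ?enum_uniq.
have memh z : (z \in map h (enum P)) = on_form (6 * N + 1) z.
  apply/mapP/idP => [[x] | on_z]; first by rewrite mem_enum memP => ? ->.
  case: z on_z => X Y on_z; have /andP[/= Y0 /eqP E] := on_z.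
  have [j le_j Ej] := pentagonal_root_surj E le_Na.
  have lt_Y : Y.-1 < a.+1 by nia.
  have hE : h (Ordinal lt_Y, Ordinal (le_j : j < (a + a).+1)) = (X, Y).
    by rewrite /h /= Ej prednK.
  by exists (Ordinal lt_Y, Ordinal (le_j : j < (a + a).+1)); rewrite ?mem_enum ?memP hE.
move=> z; rewrite !memh; apply: form_involutionP => //; lia.
Qed.

(** -12 is not a square modulo 5. *)
Lemma dvd5_form12 X Y : 5 %| X * X + 12 * (Y * Y) -> 25 %| X * X + 12 * (Y * Y).
Proof.
rewrite (divn_eq X 5) (divn_eq Y 5).
move: (X %/ 5) (Y %/ 5) => b d.
have : X %% 5 < 5 by rewrite ltn_mod.
have : Y %% 5 < 5 by rewrite ltn_mod.
move: (X %% 5) (Y %% 5) => u v.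
case: v => [|[|[|[|[|v]]]]] // _; case: u => [|[|[|[|[|u]]]]] // _; nia.
Qed.

End Representations.

Section Modulo4.

Variables (A R : comNzRingType) (N : nat) (q : A) (cf : {additive A -> R}).
Hypothesis q0 : q ^+ N.*2.+1 = 0.
Hypothesis cfq : forall e, cf (q ^+ e) = (e == N.*2)%:R.
Hypothesis A4 : 4%:R = 0 :> A.
Hypothesis R4 : 4%:R = 0 :> R.

Local Notation y := (q ^+ 2).
Local Notation M := N.+1.

Lemma euler_exp4 (z : A) m : euler z m ^+ 4 = euler (z ^+ 2) m ^+ 2.
Proof.
rewrite /euler -!prodrXl; apply: eq_bigr => i _; rewrite (exprAC _ 2).
move: (z ^+ i.+1) => w.
transitivity ((1 - w ^+ 2) ^+ 2 - 4%:R * (w * (1 - w) ^+ 2)); first by ring.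
by rewrite A4 mul0r subr0.
Qed.

(** Multiplying the generating function by f_1^2 replaces its denominator by
f_1^4 = f_2^2, which is then cancelled. *)
Lemma EObar_series_mod4 : EObar_series N q = euler y M ^+ 2 * euler (y ^+ 2) M.
Proof.
have y20 : (y ^+ 2) ^+ M = 0 by apply: nilpotentX => //; apply: y_nilpotent.
apply: (@euler_cancel _ M (y ^+ 2) M _ _ y20).
apply: (@euler_cancel _ M (y ^+ 2) M _ _ y20).
rewrite [LHS]mulrA -expr2 -euler_exp4 (exprD _ 2 2) -mulrA EObar_series_euler //.
by ring.
Qed.

Lemma EObar_series_theta a : (M.*2 <= a)%N ->
  EObar_series N q
  = theta y a * (theta (y ^+ 2) a * euler ((y ^+ 2) ^+ 2) M).
Proof.
move=> le_a; have y20 : (y ^+ 2) ^+ M = 0 by apply: nilpotentX => //; apply: y_nilpotent.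
rewrite EObar_series_mod4 (euler_gauss (y_nilpotent q0) le_a) -mulrA -expr2.
by rewrite (euler_gauss y20 le_a).
Qed.

Lemma sign_double (B : comNzRingType) s (x : B) : 4%:R = 0 :> B ->
  ((-1) ^+ s * x) *+ 2 = x *+ 2.
Proof.
move=> B4; rewrite -signr_odd; case: (odd s); rewrite ?mul1r // expr1.
transitivity (x *+ 2 - 4%:R * x); first by ring.
by rewrite B4 mul0r subr0.
Qed.

Lemma theta_mod4 (z : A) a : 
  theta z a = 1 + (\sum_(s < a) z ^+ (s.+1 * s.+1)) *+ 2.
Proof.
rewrite /theta -!sumrMnl; congr (_ + _); apply: eq_bigr => s _.
by rewrite sign_double // mulnn.
Qed.

Lemma cf_sign s e : cf ((-1) ^+ s * q ^+ (2 * e)) = (-1) ^+ s * (e == N)%:R.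
Proof. by rewrite raddfMsign cfq -mul2n eqn_pmul2l. Qed.

Lemma EObar_series_4 : (5 %| 6 * N + 1)%N -> ~~ (25 %| 6 * N + 1)%N ->
  cf (EObar_series N q) = 0.
Proof.
move=> D5 D25; pose a := M.*2.
have z0 : ((y ^+ 2) ^+ 2) ^+ M = 0 by do 2![apply: nilpotentX => //]; apply: y_nilpotent.
rewrite (EObar_series_theta (leqnSn a)) !theta_mod4.
set E := euler _ M; set S := \sum_(s < _) _; set S' := \sum_(s < _) _.
have -> : (1 + S *+ 2) * ((1 + S' *+ 2) * E) = E + (S' * E) *+ 2 + (S * E) *+ 2.
  transitivity (E + (S' * E) *+ 2 + (S * E) *+ 2 + 4%:R * (S * S' * E)).
    by ring.
  by rewrite A4 mul0r addr0.
have EE : E = \sum_(j < (a + a).+1)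
    (-1) ^+ ((j - a) + (a - j)) * q ^+ (2 * (4 * pentagonal a j)).
  rewrite /E (euler_pentagonal z0 (leqnn a)); apply: eq_bigr => j _.
  by congr (_ * _); rewrite -!exprM; congr (_ ^+ _); lia.
have no12 Y j : (2 * (Y * Y) + 4 * pentagonal a j)%N != N.
  apply: contraNneq D25 => EN; move: D5; rewrite -EN.
  have -> : (6 * (2 * (Y * Y) + 4 * pentagonal a j) + 1
    = pentagonal_root a j * pentagonal_root a j + 12 * (Y * Y))%N.
    by rewrite -pentagonal_rootE; lia.
  exact: dvd5_form12.
have cfE : cf E = 0.
  rewrite EE raddf_sum big1 // => j _; rewrite cf_sign.
  by have := no12 0%N j; rewrite add0n => /negPf ->; rewrite mulr0.
have cfS' : cf (S' * E) = 0.
  rewrite EE mulr_suml raddf_sum big1 // => s _.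
  rewrite mulr_sumr raddf_sum big1 // => j _ /=.
  rewrite mulrCA; set e := (s.+1 * _)%N.
  have -> : (y ^+ 2) ^+ e * q ^+ (2 * (4 * pentagonal a j))
            = q ^+ (2 * (2 * e + 4 * pentagonal a j)).
    by rewrite -!exprM -exprD; congr (_ ^+ _); lia.
  by rewrite cf_sign (negPf (no12 s.+1 j)) mulr0.
rewrite 2!raddfD !raddfMn cfE cfS' mul0rn !add0r.
rewrite EE mulr_suml raddf_sum -sumrMnl.
pose P := [set x : 'I_a.+1 * 'I_(a + a).+1 |
             x.1.+1 * x.1.+1 + 4 * pentagonal a x.2 == N]%N.
transitivity (#|P|%:R *+ 2 : R).
  have -> : #|P|%:R *+ 2 = \sum_(s < a.+1) \sum_(j < (a + a).+1)
                             (if (s, j) \in P then 1 *+ 2 else 0) :> R.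
    rewrite pair_bigA /= -sum1_card natr_sum -sumrMnl big_mkcond.
    by apply: eq_bigr => -[s j].
  apply: eq_bigr => s _; rewrite mulr_sumr raddf_sum -sumrMnl.
  apply: eq_bigr => j _ /=.
  rewrite mulrCA -exprM -exprD -mulnDr cf_sign sign_double // inE /=.
  by case: eqP => _ //; rewrite mul0rn.
have le_Na : (N <= a)%N by rewrite /a; lia.
have := even_representations le_Na D5 D25; rewrite -/P => /even_halfK <-.
rewrite -muln2 natrM; transitivity (4%:R * #|P|./2%:R : R); first by ring.
by rewrite R4 mul0r.
Qed.

End Modulo4.

Lemma EObar_dvd4 N : (5 %| 6 * N + 1)%N -> ~~ (25 %| 6 * N + 1)%N ->
  (4 %| EObar N.*2)%N.
Proof.
move=> D5 D25; have [A [q [cf [q0 cfq An]]]] := truncated_series_ring 'Z_4 N.*2.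
have R4 : 4%:R = 0 :> 'Z_4 by apply: val_inj.
have := EObar_seriesP cfq; rewrite (EObar_series_4 q0 cfq (An _ R4) R4) //.
by move/(congr1 (@nat_of_ord _)); rewrite val_Zp_nat // => /esym/eqP.
Qed.

Local Close Scope ring_scope.

Theorem theorem1p3 (t : nat) (ht : t \in [:: 1; 2; 3; 4]) (n : nat) :
  EObar (10 * (5 * n + t) + 8) = 0 %[mod 20].
Proof.
have t14 : (0 < t < 5)%N by move: ht; rewrite !inE; lia.
pose N := (5 * (5 * n + t) + 4)%N.
have -> : (10 * (5 * n + t) + 8 = N.*2)%N by rewrite /N; lia.
rewrite mod0n; apply/eqP.
rewrite -[_ == _]/(20 %| EObar N.*2)%N (@Gauss_dvd 4 5) // EObar_dvd4 ?EObar_dvd5 //.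
all: by rewrite /N; lia.
Qed.
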